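(* Let $\mathrm{Int}(\mathbb{Z})=\{f\in\mathbb{Q}[X] : f(\mathbb{Z})\subseteq\mathbb{Z}\}$ be the ring of integer-valued polynomials. Then $\mathrm{Int}(\mathbb{Z})$ does not have the property that every invertible $2\times 2$ matrix with entries in it is a product of elementary matrices; that is, there exists an invertible $2\times 2$ matrix over $\mathrm{Int}(\mathbb{Z})$ that is not a product of elementary matrices over $\mathrm{Int}(\mathbb{Z})$.
   Context: Elementary matrices over a commutative ring $R$ are the invertible matrices corresponding to elementary row operations: matrices differing from the identity in one off-diagonal entry, permutation (row-swap) matrices, and matrices obtained from the identity by replacing a diagonal entry with a unit of $R$. *)

(* Defs.v *)
From HB Require Import structures.
From mathcomp Require Import all_boot all_order all_algebra.
From mathcomp Require Import boolp.

Set Implicit Arguments.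
Unset Strict Implicit.
Unset Printing Implicit Defensive.

Import GRing.Theory Num.Theory.
Local Open Scope ring_scope.

Definition int_valued : {pred {poly rat}} :=
  fun f => `[< forall n : int, f.[n%:~R] \is a Num.int >].

Lemma int_valuedP (f : {poly rat}) :
  reflect (forall n : int, f.[n%:~R] \is a Num.int) (f \in int_valued).
Proof. exact: asboolP. Qed.

Lemma int_valued_subring : subring_closed int_valued.
Proof.
split.
- by apply/int_valuedP => n; rewrite hornerC rpred1.
- move=> f g /int_valuedP hf /int_valuedP hg; apply/int_valuedP => n.
  by rewrite hornerD hornerN rpredB.
- move=> f g /int_valuedP hf /int_valuedP hg; apply/int_valuedP => n.
  by rewrite hornerM rpredM.
Qed.

HB.instance Definition _ :=
  GRing.isSubringClosed.Build {poly rat} int_valued int_valued_subring.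

Record IntZ : Type := MkIntZ {
  IntZ_val :> {poly rat};
  IntZ_valP : IntZ_val \in int_valued
}.

HB.instance Definition _ := [isSub for IntZ_val].
HB.instance Definition _ := [Choice of IntZ by <:].
HB.instance Definition _ := [SubChoice_isSubComNzRing of IntZ by <:].

(* [int_valued] is not closed under inverses taken in {poly rat} (2 has no
   inverse in Int(Z)), so the units have to be cut out explicitly; [IntZ_unitP]
   shows that they are exactly the invertible elements of Int(Z). *)
Definition IntZ_unit : {pred IntZ} :=
  fun f => (val f \is a GRing.unit) && ((val f)^-1 \in int_valued).

Definition IntZ_inv (f : IntZ) : IntZ := insubd f (val f)^-1.

Fact IntZ_mulVx : {in IntZ_unit, left_inverse 1 IntZ_inv *%R}.
Proof.
move=> f /andP[uf vf]; apply: val_inj.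
by rewrite rmorphM rmorph1 /= insubdK // mulVr.
Qed.

Fact IntZ_unitPl (f g : IntZ) : g * f = 1 -> IntZ_unit f.
Proof.
move=> /(congr1 val); rewrite rmorphM rmorph1 /= => gf1.
have uf : val f \is a GRing.unit.
  by apply/unitrP; exists (val g); split=> //; rewrite mulrC.
rewrite /IntZ_unit uf /=.
suff -> : (IntZ_val f)^-1 = val g by exact: IntZ_valP.
by rewrite -[LHS]mul1r -gf1 mulrK.
Qed.

Fact IntZ_invr_out : {in [predC IntZ_unit], IntZ_inv =1 id}.
Proof.
move=> f; rewrite !inE /IntZ_unit /IntZ_inv unfold_in negb_and => h.
case: (boolP ((val f)^-1 \in int_valued)) h => [vf|nvf _].
  rewrite orbF => nuf; apply: val_inj.
  by rewrite invr_out // valKd.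
by rewrite /insubd insubN.
Qed.

HB.instance Definition _ := GRing.ComNzRing_hasMulInverse.Build IntZ
  IntZ_mulVx IntZ_unitPl IntZ_invr_out.

Lemma IntZ_unitP (f : IntZ) :
  reflect (exists g : IntZ, g * f = 1) (f \is a GRing.unit).
Proof.
apply: (iffP idP) => [uf|[g]]; first by exists f^-1; rewrite mulVr.
exact: IntZ_unitPl.
Qed.

Inductive elementary_mx (R : comUnitRingType) (n : nat) : 'M[R]_n -> Prop :=
| Elementary_add (i j : 'I_n) (a : R) of i != j :
    elementary_mx (1%:M + a *: delta_mx i j)
| Elementary_swap (i j : 'I_n) of i != j :
    elementary_mx (tperm_mx i j)
| Elementary_scale (i : 'I_n) (u : R) of u \is a GRing.unit :
    elementary_mx (diag_mx (\row_j (if j == i then u else 1))).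

Definition elementary_product (R : comUnitRingType) (n : nat) (A : 'M[R]_n) :
    Prop :=
  exists2 s : seq 'M[R]_n,
    forall E, E \in s -> elementary_mx E & A = \big[mulmx/1%:M]_(E <- s) E.

(* Main.v *)
(* Ordered by the sign of the leading coefficient, Int(Z) is discretely ordered:
   no element lies strictly between 0 and 1, because a constant polynomial in
   Int(Z) is an integer. Over a discretely ordered ring (P. M. Cohn), the first
   row (x, y) of a product of elementary 2 x 2 matrices is, up to order and
   signs, built from (1, 0) by inverting the steps of Euclid's algorithm; hence,
   if y > 0, then 0 <= x - q y < y for some q. Cohn's matrix
   [[1 + 2X, 4], [-X^2, 1 - 2X]] has determinant 1, but 0 <= 1 + 2X - 4q < 4
   forces 1 + 2X - 4q to be constant, so that q has slope 1/2 and is not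
   integer-valued. *)
Require Import Defs.
From HB Require Import structures.
From mathcomp Require Import all_boot all_order all_algebra.
From mathcomp Require Import perm ring lra zify.

Set Implicit Arguments.
Unset Strict Implicit.
Unset Printing Implicit Defensive.

Import Order.TTheory GRing.Theory Num.Theory.
Local Open Scope ring_scope.

(** * Euclid's algorithm over a discretely ordered ring *)

Section DiscretelyOrdered.
Variable R : realDomainType.
Hypothesis discrete : forall x : R, 0 < x -> 1 <= x.

(** Consecutive remainders of a run of Euclid's algorithm that ends in (1, 0), the larger one first.
    The strict inequality excludes (1, 1), so remainders strictly decrease. *)
Inductive euclid_pair : R -> R -> Prop :=
| EuclidUnit : euclid_pair 1 0
| EuclidStep a b q of euclid_pair a b & 1 <= q & a < q * a + b :
    euclid_pair (q * a + b) a.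

Lemma euclid_pair_bounds (a b : R) : euclid_pair a b -> 0 <= b < a.
Proof.
elim=> [|{}a {}b q _ /andP[b0 ba] q1 lt]; first by rewrite lexx ltr01.
by rewrite lt andbT; apply: le_trans b0 (ltW ba).
Qed.

Lemma euclid_pair0 (a : R) : euclid_pair a 0 -> a = 1.
Proof.
move Eb: 0 => b h; case: h Eb => // {}a c q h _ _ Ea.
have := euclid_pair_bounds h; rewrite -Ea => /andP[/le_lt_trans h1 /h1].
by rewrite ltxx.
Qed.

Lemma euclid_pair_inv (a b : R) : euclid_pair a b -> 0 < b ->
  exists q r, [/\ euclid_pair b r, 1 <= q & a = q * b + r].
Proof.
case=> [|{}a {}b q h q1 _ _]; first by rewrite ltxx.
by exists q, b.
Qed.

Lemma discreteS (x y : R) : x < y -> x + 1 <= y.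
Proof. by rewrite -subr_gt0 => /discrete; lra. Qed.

(* Allows a change of sign of the dividend: if x = q y + b with 0 < b < y, then
   - x leaves the remainder y - b. *)
Lemma euclid_pair_compl (a b : R) :
  euclid_pair a b -> 0 < b -> euclid_pair a (a - b).
Proof.
move=> h b0; have /andP[_ ba] := euclid_pair_bounds h.
have [q [r [hb q1 Ea]]] := euclid_pair_inv h b0.
have /andP[r0 rb] := euclid_pair_bounds hb.
have [Eq|q2] : q = 1 \/ 2 <= q.
- by move: q1; rewrite le_eqVlt => /predU1P[->|/discreteS]; [left | right; lra].
(* Quotient 1: a - b is the next remainder r, and b = p r + s gives a = (p + 1) r + s. *)
- have Er : a - b = r by rewrite Ea Eq; ring.
  have r_gt0 : 0 < r by lra.
  have [p [s [hr p1 Eb]]] := euclid_pair_inv hb r_gt0.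
  have /andP[s0 sr] := euclid_pair_bounds hr.
  have Ea' : a = (p + 1) * r + s by rewrite Ea Eq Eb; ring.
  by rewrite Er Ea'; apply: EuclidStep => //; [lra | rewrite -Ea'; lra].
(* Quotient at least 2: unless a - b = b, the division splits into a = 1 (a - b) + b and a - b = (q
   - 1) b + r. *)
have Eab : a - b = (q - 1) * b + r by rewrite Ea; ring.
have : b <= a - b by rewrite Eab; nra.
rewrite le_eqVlt => /predU1P[Ebb|lt]; first by rewrite -Ebb.
have hab : euclid_pair (a - b) b.
  by rewrite Eab; apply: EuclidStep => //; [lra | rewrite -Eab].
have {1}-> : a = 1 * (a - b) + b by ring.
by apply: EuclidStep => //; lra.
Qed.

(** Only the pair ([|y|], b) is in normal form; [x] and [y] may have any signs, and [x] any size. *)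
Definition euclid_row (x y : R) :=
  exists q b, euclid_pair `|y| b /\ x = q * y + b.

Lemma euclid_rowNr (x y : R) : euclid_row x y -> euclid_row x (- y).
Proof. by case=> q [b [h ->]]; exists (- q), b; rewrite normrN mulrNN. Qed.

Lemma euclid_rowNl (x y : R) : euclid_row x y -> euclid_row (- x) y.
Proof.
case=> q [b [h ->]]; have /andP[] := euclid_pair_bounds h.
rewrite le_eqVlt => /predU1P[b0 _|b0 _].
  by exists (- q), b; rewrite -b0 in h *; split=> //; ring.
(* Adding [|y|] = sg(y) y to the negative remainder - b makes it positive. *)
exists (- q - Num.sg y), (`|y| - b); split; first exact: euclid_pair_compl.
by rewrite [`|y|]normrEsg; ring.
Qed.

Lemma euclid_rowDl (x y c : R) : euclid_row x y -> euclid_row (x + c * y) y.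
Proof. by case=> q [b [h ->]]; exists (q + c), b; split=> //; ring. Qed.

Lemma euclid_row_neq0 x y : euclid_row x y -> y != 0.
Proof.
case=> q [b [/euclid_pair_bounds /andP[b0 /(le_lt_trans b0)]]].
by rewrite normr_gt0.
Qed.

(** Let y = q x + b; positivity gives q >= 0. If q = 0, then (x, y) is a pair and its last step is
    undone. Otherwise x <= y: if x < y, one more step makes (y, x) a pair; if x = y, both are 1. *)
Lemma euclid_row_pos_sym (x y : R) :
  0 < x -> 0 < y -> euclid_row y x -> euclid_row x y.
Proof.
move=> x0 y0 [q [b [h Ey]]]; rewrite gtr0_norm // in h.
have /andP[b0 bx] := euclid_pair_bounds h.
have q0 : 0 <= q.
  rewrite leNgt; apply/negP => /discreteS q_lt.
  by have := mulr_le0_ge0 q_lt (ltW x0); lra.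
move: q0; rewrite le_eqVlt => /predU1P[q0|/discrete q1].
  have Eyb : y = b by rewrite Ey -q0; ring.
  rewrite -Eyb in h; have [p [r [hy _ Ex]]] := euclid_pair_inv h y0.
  by exists p, r; rewrite gtr0_norm.
have : x <= y by rewrite Ey; nra.
rewrite le_eqVlt => /predU1P[Exy|xy].
  have Eb : b = 0.
    move: b0; rewrite le_eqVlt => /predU1P[<-//|/discrete b1].
    have : x < y by rewrite Ey; nra.
    by rewrite Exy ltxx.
  rewrite Eb in h; rewrite -Exy (euclid_pair0 h).
  by exists 1, 0; rewrite normr1; split; [exact: EuclidUnit | ring].
exists 0, x; rewrite gtr0_norm //; split; last by ring.
by rewrite Ey; apply: EuclidStep => //; rewrite -Ey.
Qed.

Lemma euclid_row_sym (x y : R) : euclid_row y x -> y != 0 -> euclid_row x y.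
Proof.
move=> h y0; have x0 := euclid_row_neq0 h.
wlog xp : x y h x0 y0 / 0 < x.
  move=> W; have [xn|xp] := orP (lt_total x0); last exact: W.
  rewrite -[x]opprK; apply: euclid_rowNl; apply: W => //.
  - exact: euclid_rowNr.
  - by rewrite oppr_eq0.
  - by rewrite oppr_gt0.
have [yn|yp] := orP (lt_total y0); last exact: euclid_row_pos_sym.
rewrite -[y]opprK; apply: euclid_rowNr; apply: euclid_row_pos_sym => //.
  by rewrite oppr_gt0.
exact: euclid_rowNl.
Qed.

(** [euclid_row x y] forces y to be nonzero, so the second disjunct is what admits (1, 0). For
    nonzero entries the two disjuncts are equivalent. *)
Definition euclidean (x y : R) := euclid_row x y \/ euclid_row y x.

Lemma euclidean_sym (x y : R) : euclidean x y -> euclidean y x.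
Proof. by case; [right | left]. Qed.

Lemma euclideanDl (x y c : R) : euclidean x y -> euclidean (x + c * y) y.
Proof.
case=> [h|h]; first by left; apply: euclid_rowDl.
have [y0|y0] := eqVneq y 0; last by left; apply/euclid_rowDl/euclid_row_sym.
by right; rewrite y0 mulr0 addr0 -y0.
Qed.

Lemma euclideanN (x y : R) : euclidean x y -> euclidean (- x) y.
Proof.
by case=> h; [left; apply: euclid_rowNl | right; apply: euclid_rowNr].
Qed.

(** By discreteness [|u|] and [|u^-1|] are both at least 1, and their product is 1. *)
Lemma norm_unit (u : R) : u \is a GRing.unit -> `|u| = 1.
Proof.
move=> uU; have uv : `|u| * `|u^-1| = 1 by rewrite -normrM divrr ?normr1.
have ge1 (w : R) : w \is a GRing.unit -> 1 <= `|w|.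
  move=> wU; apply: discrete; rewrite normr_gt0.
  by apply: contraTneq wU => ->; rewrite unitr0.
have := ge1 _ uU; have := ge1 u^-1; rewrite unitrV => /(_ uU).
by move=> v1 u1; apply/le_anti; rewrite u1 andbT; nra.
Qed.

Lemma euclideanZ (x y u : R) :
  u \is a GRing.unit -> euclidean x y -> euclidean (u * x) y.
Proof.
move/norm_unit => u1 h; have [->|->] : u = 1 \/ u = - 1.
- have /eqP := u1; rewrite eqr_norml ler01 andbT.
  by case/orP=> /eqP->; [left | right].
- by rewrite mul1r.
by rewrite mulN1r; apply: euclideanN.
Qed.

(** * First rows of products of elementary matrices *)

Definition euclidean_row0 m (A : 'M[R]_(m.+1, 2)) := euclidean (A 0 0) (A 0 1).

(** Right multiplication acts on columns, so row 0 undergoes a shear, a swap, or a scaling by a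
    unit, that is, by a sign. *)
Lemma euclidean_row0_elementary m (A : 'M[R]_(m.+1, 2)) (E : 'M[R]_2) :
  elementary_mx E -> euclidean_row0 A -> euclidean_row0 (A *m E).
Proof.
have ord2 (k : 'I_2) : k = 0 \/ k = 1.
  by case: k => [[|[|//]] ?]; [left|right]; apply: val_inj.
rewrite /euclidean_row0 => - [] {E}.
- move=> i j a; have AEE k : (A *m (1%:M + a *: delta_mx i j)) 0 k
      = A 0 k + a * (A 0 i * (j == k)%:R).
    rewrite mulmxDr mulmx1 -scalemxAr !mxE; congr (_ + a * _).
    rewrite (bigD1 i) //= mxE eqxx big1 ?addr0 1?eq_sym // => l li.
    by rewrite mxE (negPf li) mulr0.
  rewrite !AEE; case: (ord2 i) (ord2 j) => -> [] -> // _ h;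
    rewrite !eqxx /= ?mulr0 ?mulr1 ?addr0.
    exact/euclidean_sym/euclideanDl/euclidean_sym.
  exact: euclideanDl.
- move=> i j; rewrite -xcolE !mxE.
  by case: (ord2 i) (ord2 j) => -> [] -> // _ h; rewrite ?tpermL ?tpermR;
    apply: euclidean_sym.
move=> i u uU; rewrite mul_mx_diag !mxE ![_ * (if _ then _ else _)]mulrC.
case: (ord2 i) => -> h; rewrite /= mul1r; first exact: euclideanZ.
exact/euclidean_sym/euclideanZ/euclidean_sym.
Qed.

Lemma euclidean_row0_product m (A : 'M[R]_(m.+1, 2)) (P : 'M[R]_2) :
  elementary_product P -> euclidean_row0 A -> euclidean_row0 (A *m P).
Proof.
case=> s sE ->; elim: s sE A => [_ A|E s IH sE A hA].
  by rewrite big_nil mulmx1.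
rewrite big_cons mulmxA; apply: IH => [F Fs|].
  by apply: sE; rewrite inE Fs orbT.
by apply: euclidean_row0_elementary hA; apply: sE; rewrite inE eqxx.
Qed.

(** The row (1, 0) of the identity is euclidean, hence so is row 0 of [P]. As [P 0 1] is nonzero,
    this can be read as a division by [P 0 1]. *)
Lemma elementary_product_division (P : 'M[R]_2) :
  elementary_product P -> 0 < P 0 1 ->
  exists q, 0 <= P 0 0 - q * P 0 1 < P 0 1.
Proof.
move=> hP y0.
have h1 : euclidean_row0 (1%:M : 'M[R]_2).
  by right; exists 0, 0; rewrite !mxE normr1 mul0r addr0; split;
    first exact: EuclidUnit.
have := euclidean_row0_product hP h1; rewrite mul1mx => h.
have {h} [q [b [h ->]]] : euclid_row (P 0 0) (P 0 1).
  by case: h => // h; apply: euclid_row_sym => //; rewrite gt_eqF.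
exists q; rewrite addrC addKr -(gtr0_norm y0).
exact: euclid_pair_bounds h.
Qed.

End DiscretelyOrdered.

(** * Int(Z) as a discretely ordered domain *)

Lemma IntZ_mulf_eq0 (f g : IntZ) : f * g = 0 -> (f == 0) || (g == 0).
Proof. by move/(congr1 val)/eqP; rewrite /= mulf_eq0. Qed.

HB.instance Definition _ := GRing.ComUnitRing_isIntegral.Build IntZ
  IntZ_mulf_eq0.

Definition IntZ_le (f g : IntZ) := 0 <= lead_coef (val (g - f)).
Definition IntZ_norm (f : IntZ) := if IntZ_le 0 f then f else - f.

(** In equal degrees, nonnegative leading coefficients cannot cancel unless both vanish. *)
Lemma lead_coef_ge0D (p q : {poly rat}) :
  0 <= lead_coef p -> 0 <= lead_coef q -> 0 <= lead_coef (p + q).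
Proof.
move=> p0 q0; case: (ltngtP (size p) (size q)) => [lt|lt|eq].
- by rewrite lead_coefDr.
- by rewrite lead_coefDl.
have [->|pn0] := eqVneq p 0; first by rewrite add0r.
have pp : 0 < lead_coef p by rewrite lt_def lead_coef_eq0 pn0.
have cpq : (p + q)`_(size p).-1 = lead_coef p + lead_coef q.
  by rewrite coefD !lead_coefE eq.
have spq : size (p + q) = size p.
  apply/anti_leq; rewrite (leq_trans (size_polyD _ _)) ?eq ?maxnn //= -eq.
  have sp : (0 < size p)%N by rewrite size_poly_gt0.
  rewrite -(prednK sp) ltnNge; apply/negP => /leq_sizeP /(_ _ (leqnn _)).
  by rewrite cpq; move: pp q0; lra.
by rewrite lead_coefE spq cpq addr_ge0.
Qed.

Fact IntZ_le0D (f g : IntZ) : IntZ_le 0 f -> IntZ_le 0 g -> IntZ_le 0 (f + g).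
Proof. by rewrite /IntZ_le !subr0; apply: lead_coef_ge0D. Qed.

Fact IntZ_le0M (f g : IntZ) : IntZ_le 0 f -> IntZ_le 0 g -> IntZ_le 0 (f * g).
Proof. by rewrite /IntZ_le !subr0 /= lead_coefM; apply: mulr_ge0. Qed.

Fact IntZ_le0_anti (f : IntZ) : IntZ_le 0 f -> IntZ_le f 0 -> f = 0.
Proof.
rewrite /IntZ_le subr0 sub0r /= lead_coefN oppr_ge0 => f0 f0'.
by apply/val_inj/eqP; rewrite /= -lead_coef_eq0; apply/eqP/le_anti/andP.
Qed.

Fact IntZ_sub_ge0 (f g : IntZ) : IntZ_le 0 (g - f) = IntZ_le f g.
Proof. by rewrite /IntZ_le subr0. Qed.

Fact IntZ_le0_total (f : IntZ) : IntZ_le 0 f || IntZ_le f 0.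
Proof. by rewrite /IntZ_le subr0 sub0r /= lead_coefN oppr_ge0 le_total. Qed.

Fact IntZ_normN (f : IntZ) : IntZ_norm (- f) = IntZ_norm f.
Proof.
have neg : IntZ_le 0 (- f) = IntZ_le f 0 by rewrite -sub0r IntZ_sub_ge0.
rewrite /IntZ_norm neg opprK; case: ifP => f0; case: ifP => f0' //.
  by rewrite (IntZ_le0_anti f0' f0) oppr0.
by have := IntZ_le0_total f; rewrite f0 f0'.
Qed.

Fact IntZ_ge0_norm (f : IntZ) : IntZ_le 0 f -> IntZ_norm f = f.
Proof. by rewrite /IntZ_norm => ->. Qed.

HB.instance Definition _ := Num.IntegralDomain_isLeReal.Build IntZ
  IntZ_le0D IntZ_le0M IntZ_le0_anti IntZ_sub_ge0 IntZ_le0_total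
  IntZ_normN IntZ_ge0_norm (fun _ _ => erefl).

Lemma IntZ_ge0E (f : IntZ) : (0 <= f) = (0 <= lead_coef (val f)).
Proof. by rewrite -[LHS]/(IntZ_le 0 f) /IntZ_le subr0. Qed.

(** Subtracting 1 keeps the leading coefficient of a nonconstant f; a constant f equals its value at
    0, an integer. *)
Lemma IntZ_discrete (f : IntZ) : 0 < f -> 1 <= f.
Proof.
rewrite lt_def => /andP[fn0]; rewrite -[1 <= f]subr_ge0 !IntZ_ge0E /= => f0.
have [s1|s1] := leqP (size (val f)) 1; last first.
  by rewrite lead_coefDl ?size_polyN ?size_poly1.
have /int_valuedP/(_ 0) := IntZ_valP f.
have fn0' : IntZ_val f != 0 by [].
move: f0 fn0'; rewrite (size1_polyC s1) -polyC1 -polyCB !lead_coefC hornerC.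
rewrite polyC_eq0.
move=> f0 fn0' /intrP[z Ez]; move: f0 fn0'; rewrite Ez ler0z intr_eq0 => z0 zn0.
by rewrite subr_ge0 ler1z -gtz0_ge1 lt_def zn0.
Qed.

(** * Cohn's matrix *)

Lemma polyX_int_valued : 'X \in int_valued.
Proof. by apply/int_valuedP => n; rewrite hornerX intr_int. Qed.

Definition IntZ_X := MkIntZ polyX_int_valued.

Lemma IntZ_no_division (q : IntZ) : ~~ (0 <= 1 + 2 * IntZ_X - q * 4 < 4).
Proof.
set r := _ - _; apply/negP; rewrite lt_def -[r <= 4]subr_ge0 !IntZ_ge0E.
case/and3P=> r_ge0 _; rewrite rmorphB rmorph_nat => r_le4.
(* If r were nonconstant, 4 - r would have the opposite leading coefficient, and both could not be
   nonnegative. *)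
have s1 : (size (val r) <= 1)%N.
  rewrite leqNgt; apply/negP => s1.
  move: r_le4; rewrite lead_coefDr; last first.
    by rewrite size_polyN -polyC_natr (leq_ltn_trans (size_polyC_leq1 _)).
  rewrite lead_coefN oppr_ge0 => r_le0.
  have : lead_coef (val r) == 0 by apply/eqP/le_anti/andP.
  by rewrite lead_coef_eq0 => /eqP r0; rewrite r0 size_poly0 in s1.
have rE : val r = 1 + 2 * 'X - val q * 4.
  by rewrite rmorphB rmorphD rmorph1 !rmorphM !rmorph_nat.
have re (x : rat) : (val r).[x] = 1 + 2 * x - (val q).[x] * 4.
  by rewrite rE -!polyC_natr !hornerE.
(* The constant r has equal values at 0 and 1, so 2 q(1) = 2 q(0) + 1 in integers, against
   parity. *)
have := re 0; have := re 1; rewrite (size1_polyC s1) !hornerC => ->.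
have /int_valuedP qI := IntZ_valP q.
have /intrP[z1 Ez1] := qI 1; have /intrP[z0 Ez0] := qI 0.
rewrite (Ez1 : (val q).[1] = _) (Ez0 : (val q).[0] = _) => E.
have {E} : (z1 * 2)%:~R = (z0 * 2 + 1)%:~R :> rat.
  by rewrite rmorphD !rmorphM /=; lra.
by move/intr_inj; lia.
Qed.

Definition Cohn_mx : 'M[IntZ]_2 :=
  \matrix_(i, j) if i == 0 then (if j == 0 then 1 + 2 * IntZ_X else 4)
                 else (if j == 0 then - IntZ_X ^+ 2 else 1 - 2 * IntZ_X).

Theorem theorem4p13 :
  exists2 A : 'M[IntZ]_2, A \in unitmx & ~ elementary_product A.
Proof.
exists Cohn_mx.
  rewrite unitmxE (expand_det_row _ 0) !big_ord_recl big_ord0.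
  rewrite /cofactor !det_mx11 !mxE /= [X in X \is a _](_ : _ = 1) ?unitr1 //; ring.
move/(elementary_product_division IntZ_discrete).
rewrite !mxE /= => /(_ (ltr0n _ 4)).
by case=> q; apply/negP/IntZ_no_division.
Qed.
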